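(* The symplectic Zauner's conjecture is equivalent to the skew Hadamard conjecture; that is, the following two assertions are equivalent. (SZ) For every even integer $d\ge2$ and every positive integer $n$, there exists a $d\times n$ equiangular tight frame (ETF) in real symplectic space $\mathbb{R}_{\mathcal S}^d$ if and only if either $n=d$ and ($d\equiv0\bmod4$ or $d=2$), or $n=d+1$ and $d\equiv2\bmod4$. (SH) For every positive integer $m$ such that $m=1$, $m=2$, or $m$ is a multiple of $4$, there exists a skew Hadamard matrix of order $m$. Specifically, the following hold for every even integer $d>1$: (a) There exists a $d\times d$ ETF in real symplectic space $\mathbb{R}_{\mathcal S}^d$ if and only if there exists a skew Hadamard matrix of order $d$. (b) There exists a $d\times(d+1)$ ETF in real symplectic space $\mathbb{R}_{\mathcal S}^d$ if and only if there exists a skew Hadamard matrix of order $d+2$.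
   Context: For an even integer $d\ge 2$, let $\Omega$ be the $d\times d$ block-diagonal matrix consisting of $d/2$ diagonal blocks $\begin{bmatrix}0&1\\-1&0\end{bmatrix}$, and let $[x,y]=x^\top\Omega y$ on $\mathbb{R}^d$. The space $\mathbb{R}^d$ with this symplectic form is called real symplectic space and denoted $\mathbb{R}_{\mathcal S}^d$. A sequence $\Phi=\{\varphi_i\}_{i=1}^n$ of vectors in $\mathbb{R}_{\mathcal S}^d$ is identified with the real $d\times n$ matrix whose columns are the $\varphi_i$. Put $\Phi^\dagger=\Phi^\top\Omega$. The Gram matrix of $\Phi$ is the $n\times n$ matrix $\Phi^\dagger\Phi$, with entries $(\Phi^\dagger\Phi)_{ij}=[\varphi_i,\varphi_j]$, and the frame operator is the $d\times d$ matrix $\Phi\Phi^\dagger$. The spectrum $\sigma(\cdot)$ consists of complex eigenvalues. $\Phi$ is a frame in $\mathbb{R}_{\mathcal S}^d$ if there are constants $A,B>0$ (frame bounds) with $A\le|\lambda|\le B$ for all $\lambda\in\sigma(\Phi\Phi^\dagger)$. It is $c$-tight ($c>0$) if one may take $A=B=c$, and tight if it is $c$-tight for some $c>0$. $\Phi$ is equiangular if there is $\mu>0$ with $|(\Phi^\dagger\Phi)_{ij}|=\mu$ for all $i\ne j$. A $d\times n$ ETF in $\mathbb{R}_{\mathcal S}^d$ is a sequence of $n$ vectors that is both a tight frame and equiangular. A Hadamard matrix of order $m$ is an $m\times m$ matrix $H$ with entries in $\{\pm1\}$ and $HH^\top=mI_m$. A skew Hadamard matrix of order $m$ is a Hadamard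 matrix $H$ of the form $H=C+I_m$ with $C$ skew symmetric. *)

(* Defs.v *)
(* The real numbers are an arbitrary [R : realType]; their complex numbers are [R[i]]. *)
From mathcomp Require Import all_boot all_order all_algebra.
From mathcomp Require Import complex reals.

Set Implicit Arguments.
Unset Strict Implicit.
Unset Printing Implicit Defensive.

Import Order.TTheory GRing.Theory Num.Theory.

Local Open Scope ring_scope.

(* Rows and columns 2k, 2k+1 form the k-th diagonal block [0 1; -1 0].
   This is meant for even [d] only: for odd [d] the last block is truncated. *)
Definition Omega (R : realType) (d : nat) : 'M[R]_d :=
  \matrix_(i, j) if (i./2 == j./2)%N
                 then if (i < j)%N then 1 else if (j < i)%N then -1 else 0
                 else 0.

(* A sequence of [n] vectors of R^d is the matrix having them as columns. *)
Definition dagger (R : realType) (d n : nat) (Phi : 'M[R]_(d, n)) :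
  'M[R]_(n, d) := Phi^T *m Omega R d.

Definition gram (R : realType) (d n : nat) (Phi : 'M[R]_(d, n)) : 'M[R]_n :=
  dagger Phi *m Phi.

Definition frame_operator (R : realType) (d n : nat) (Phi : 'M[R]_(d, n)) :
  'M[R]_d := Phi *m dagger Phi.

(* [eigenvalue] speaks of row eigenvectors, which for a square matrix give the
   same eigenvalues as column eigenvectors. *)
Definition in_spectrum (R : realType) (d : nat) (M : 'M[R]_d) (l : R[i]) :
  Prop := eigenvalue (map_mx (real_complex R) M) l.

Definition frame_bounds (R : realType) (d n : nat) (Phi : 'M[R]_(d, n))
  (A B : R) : Prop :=
  [/\ 0 < A, 0 < B &
      forall l : R[i], in_spectrum (frame_operator Phi) l ->
        real_complex R A <= `|l| <= real_complex R B].

Definition frame (R : realType) (d n : nat) (Phi : 'M[R]_(d, n)) : Prop :=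
  exists A B : R, frame_bounds Phi A B.

Definition tight_with (R : realType) (d n : nat) (Phi : 'M[R]_(d, n)) (c : R) :
  Prop := frame_bounds Phi c c.

Definition tight_frame (R : realType) (d n : nat) (Phi : 'M[R]_(d, n)) :
  Prop := frame Phi /\ exists c : R, tight_with Phi c.

Definition equiangular (R : realType) (d n : nat) (Phi : 'M[R]_(d, n)) :
  Prop :=
  exists2 mu : R, 0 < mu &
    forall i j : 'I_n, i != j -> `|gram Phi i j| = mu.

Definition is_ETF (R : realType) (d n : nat) (Phi : 'M[R]_(d, n)) : Prop :=
  tight_frame Phi /\ equiangular Phi.

Definition ETF_exists (R : realType) (d n : nat) : Prop :=
  exists Phi : 'M[R]_(d, n), is_ETF Phi.

Definition hadamard (m : nat) (H : 'M[int]_m) : Prop :=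
  (forall i j, H i j = 1 \/ H i j = -1) /\ H *m H^T = (m%:R)%:M.

Definition skew_hadamard (m : nat) (H : 'M[int]_m) : Prop :=
  hadamard H /\ exists2 C : 'M[int]_m, C^T = - C & H = C + 1%:M.

Definition skew_hadamard_exists (m : nat) : Prop :=
  exists H : 'M[int]_m, skew_hadamard H.

Definition symplectic_zauner_conjecture (R : realType) : Prop :=
  forall d n : nat, ~~ odd d -> (2 <= d)%N -> (0 < n)%N ->
    ETF_exists R d n <->
    (n = d /\ (d = 0 %[mod 4] \/ d = 2%N)) \/ (n = d.+1 /\ d = 2 %[mod 4]).

Definition skew_hadamard_conjecture : Prop :=
  forall m : nat, (0 < m)%N -> m = 1%N \/ m = 2%N \/ (4 %| m)%N ->
    skew_hadamard_exists m.

(* Main.v *)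
Require Import Defs.
From mathcomp Require Import all_boot all_order all_algebra.
From mathcomp Require Import complex reals.

Set Implicit Arguments.
Unset Strict Implicit.
Unset Printing Implicit Defensive.

Import Order.TTheory GRing.Theory Num.Theory.
Local Open Scope ring_scope.

(** Everything is read off the Gram matrix.  Any real skew-symmetric matrix of
    rank at most d, d even, is the Gram matrix of a sequence of vectors of
    symplectic d-space: split off hyperbolic planes one by one
    ([skew_is_gram]).  The Gram matrix G and the frame operator have the same
    nonzero eigenvalues, and G is normal, so the sequence is a tight frame
    exactly when G has rank d and satisfies G ^ 3 = - k G for some k > 0
    ([tight_gram], [gram_tight]).  After scaling, an ETF of n vectors is
    therefore the same thing as a skew n x n matrix C with off-diagonal entries
    +1 or -1, of rank d, with C ^ 3 = - k C ([ETF_existsP]).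

    A skew Hadamard matrix of order m is such a C of order m with C ^ 2 = 1 - m
    ([skew_hadamardP]).  For n = d the matrix C is invertible, the cubic identity
    reduces to C ^ 2 = - k, and the diagonal gives k = d - 1
    ([square_ETF_skew_hadamard]).  For n = d + 1 the kernel of C is a line; it is
    spanned by a vector s of signs with C ^ 2 = s^T s - n
    ([corank1_tournament]), and bordering C by s gives a skew Hadamard matrix of
    order d + 2 ([corank1_ETF_skew_hadamard]).

    These two cases settle the equivalence of the conjectures, for two reasons.
    First, n can only be d or d + 1: modulo 2 a matrix C of even order is J - 1,
    which is invertible, so the rank d of C is n or n - 1 ([ETF_size]).  Second, a
    Hadamard matrix of order greater than 2 has order divisible by 4
    ([hadamard_order]), which gives the congruences on d. *)

(** * Skew-symmetric matrices as symplectic Gram matrices *)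

Lemma skew_diag (F : numDomainType) n (G : 'M[F]_n) i : G^T = - G -> G i i = 0.
Proof.
move/matrixP/(_ i i); rewrite !mxE => /eqP.
by rewrite -subr_eq0 opprK -mulr2n mulrn_eq0 => /eqP.
Qed.

Section Gram.
Variable R : realType.

Lemma trmx_Omega d : (Omega R d)^T = - Omega R d.
Proof.
apply/matrixP => i j; rewrite !mxE eq_sym.
case: eqP => _; last by rewrite oppr0.
by case: ltngtP => _; rewrite ?opprK ?oppr0.
Qed.

Lemma trmx_gram d n (Phi : 'M[R]_(d, n)) : (gram Phi)^T = - gram Phi.
Proof.
by rewrite /gram /dagger !trmx_mul trmxK trmx_Omega mulmxA mulmxN mulNmx.
Qed.

Lemma mul_frame_operator d n (Phi : 'M[R]_(d, n)) :
  frame_operator Phi *m Phi = Phi *m gram Phi.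
Proof. by rewrite /gram mulmxA. Qed.

Lemma rank_gram_le d n (Phi : 'M[R]_(d, n)) : (\rank (gram Phi) <= d)%N.
Proof. exact: leq_trans (mxrankM_maxr _ _) (rank_leq_row _). Qed.

Lemma Omega_block d :
  Omega R (2 + d) = block_mx (Omega R 2) 0 0 (Omega R d).
Proof.
apply/matrixP => i j.
case: (splitP i) => i' Ei; case: (splitP j) => j' Ej.
- have -> : i = lshift d i' by apply: val_inj.
  have -> : j = lshift d j' by apply: val_inj.
  by rewrite block_mxEul !mxE.
- have -> : i = lshift d i' by apply: val_inj.
  have -> : j = rshift 2 j' by apply: val_inj.
  rewrite block_mxEur !mxE /=.
  by case: i' {Ei} => [[|[|]]].
- have -> : i = rshift 2 i' by apply: val_inj.
  have -> : j = lshift d j' by apply: val_inj.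
  rewrite block_mxEdl !mxE /=.
  by case: j' {Ej} => [[|[|]]].
- have -> : i = rshift 2 i' by apply: val_inj.
  have -> : j = rshift 2 j' by apply: val_inj.
  by rewrite block_mxEdr !mxE /= eqSS !ltnS.
Qed.

Lemma gram_col_mx d n (U : 'M[R]_(2, n)) (Phi : 'M[R]_(d, n)) :
  gram (col_mx U Phi) = gram U + gram Phi.
Proof.
rewrite /gram /dagger tr_col_mx Omega_block mul_row_block mul_row_col.
by rewrite !mulmx0 addr0 add0r.
Qed.

(** The Gram matrix of two row vectors stacked as coordinates of one symplectic
    plane; it plays the part that a rank-one matrix has for symmetric forms. *)
Definition wedge n (u v : 'rV[R]_n) : 'M[R]_n := u^T *m v - v^T *m u.

Lemma trmx_wedge n (u v : 'rV[R]_n) : (wedge u v)^T = - wedge u v.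
Proof. by rewrite /wedge linearB /= !trmx_mul !trmxK opprB. Qed.

Lemma gram_pair n (u v : 'rV[R]_n) :
  gram (col_mx u v : 'M_(2, n)) = wedge u v.
Proof.
apply/matrixP => k l; rewrite /wedge /gram /dagger !mxE.
rewrite !big_ord_recl !big_ord0 !mxE !big_ord_recl !big_ord0 !mxE /=.
have -> : split (ord0 : 'I_(1 + 1)) = inl 0.
  by rewrite -(unsplitK (inl 0)); congr split; apply: val_inj.
have -> : split (lift ord0 ord0 : 'I_(1 + 1)) = inr 0.
  by rewrite -(unsplitK (inr 0)); congr split; apply: val_inj.
by rewrite !mulr0 !add0r !mulr1 !addr0 mulrN1 addrC mulNr.
Qed.

(** The elimination step of the symplectic Gram-Schmidt process.  The pair of
    basis vectors i, j spans a hyperbolic plane of the form G, and the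
    subtracted wedge is the part of G carried by that plane.  What is left has
    its columns i and j equal to zero, while on the row space of G these two
    columns have rank 2; rank-nullity for the projection to these two columns
    gives the drop. *)
Lemma rank_sub_wedge n (G : 'M[R]_n) (i j : 'I_n) :
  G^T = - G -> G i j != 0 ->
  (\rank (G - wedge ((G i j)^-1 *: row i G) (row j G))%R + 2 <= \rank G)%N.
Proof.
rewrite /wedge => skG; set a := G i j => a0.
set u := a^-1 *: _; set v := row j G; set G' := G - _.
have sk k l : G k l = - G l k by rewrite -[in LHS](trmxK G) skG !mxE.
have G'i k : G' k i = 0.
  rewrite !mxE !big_ord1 !mxE (skew_diag i skG) mulr0 mulr0 subr0.
  by rewrite (sk j i) -/a mulrN opprK mulrAC mulVf // mul1r (sk k i) addNr.
have G'j k : G' k j = 0.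
  rewrite !mxE !big_ord1 !mxE (skew_diag j skG) mulr0 sub0r opprK.
  by rewrite -/a mulVf // mulr1 (sk k j) addNr.
(* right multiplication by E keeps columns i and j only *)
pose E : 'M[R]_(n, 1 + 1) :=
  row_mx (delta_mx i 0 : 'cV_n) (delta_mx j 0 : 'cV_n).
have subG' : (G' <= G :&: kermx E)%MS.
  rewrite sub_capmx; apply/andP; split.
    have -> : G' = (1%:M - (u^T *m delta_mx 0 j -
                            v^T *m (a^-1 *: delta_mx 0 i))) *m G.
      rewrite mulmxBl mul1mx mulmxBl -!mulmxA -rowE /=.
      by rewrite -scalemxAl -rowE.
    exact: submxMl.
  apply/sub_kermxP; rewrite /E mul_mx_row -!colE.
  rewrite -[RHS]row_mx0; congr row_mx; apply/matrixP => k l;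
  by rewrite mxE [RHS]mxE.
have rkE : (2 <= \rank (G *m E))%N.
  rewrite -[X in (X <= _)%N](_ : \rank (E^T *m (G *m E)) = 2%N).
    exact: mxrankM_maxr.
  rewrite mulmxA /E tr_row_mx !trmx_delta mul_col_mx -!rowE mul_col_row -!colE.
  set B := block_mx _ _ _ _.
  have defB : B = block_mx 0 a%:M (- a%:M) 0.
    rewrite /B; congr block_mx; apply/matrixP => k l;
    by rewrite !ord1 !mxE ?(skew_diag _ skG).
  suff /mulmx1_unit[uB _] : B *m block_mx 0 (- a^-1%:M) a^-1%:M 0 = 1%:M.
    exact: mxrank_unit.
  rewrite defB mulmx_block !mul0mx !mulmx0 mulNmx mulmxN opprK.
  by rewrite -!scalar_mxM mulfV // !addr0 add0r -scalar_mx_block.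
by rewrite -(mxrank_mul_ker G E) addnC leq_add // mxrankS.
Qed.

(** Splitting off one hyperbolic plane at a time writes G as a sum of at most
    d./2 wedges, and the vectors of these wedges are the rows of Phi.  Planes left
    over when the rank is less than d are filled with zero rows. *)
Lemma skew_is_gram n d (G : 'M[R]_n) :
  G^T = - G -> ~~ odd d -> (\rank G <= d)%N ->
  exists Phi : 'M[R]_(d, n), gram Phi = G.
Proof.
move=> skG evd; rewrite -(even_halfK evd); move: d./2 => {d evd} k.
elim: k G skG => [|k IH] G skG rkG.
  exists 0; move: rkG; rewrite leqn0 mxrank_eq0 => /eqP ->.
  by rewrite /gram mulmx0.
have [->|/matrix0Pn[i [j a0]]] := eqVneq G 0.
  by exists 0; rewrite /gram mulmx0.
have := rank_sub_wedge skG a0.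
set u := _ *: _; set v := row j G => /= rkG'.
have [||Phi defPhi] := IH (G - wedge u v).
- by rewrite linearB /= skG trmx_wedge opprK opprB addrC.
- by rewrite -(leq_add2r 2) (leq_trans rkG') // addn2 -doubleS.
exists (col_mx (col_mx u v : 'M_(2, n)) Phi : 'M_(2 + k.*2, n)).
by rewrite gram_col_mx gram_pair defPhi addrC subrK.
Qed.

End Gram.

(** * Tightness of a frame read off its Gram matrix *)

Lemma eigenvalue_mulmxC (F : fieldType) m n
    (A : 'M[F]_(m, n)) (B : 'M_(n, m)) l :
  l != 0 -> eigenvalue (A *m B) l -> eigenvalue (B *m A) l.
Proof.
move=> l0 /eigenvalueP[v vAB v0]; apply/eigenvalueP; exists (v *m A).
  by rewrite mulmxA -(mulmxA v) vAB scalemxAl.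
apply: contra_neq v0 => vA0; apply: (scalerI l0).
by rewrite -vAB mulmxA vA0 mul0mx scaler0.
Qed.

Lemma eigenvalue0 (F : fieldType) n (A : 'M[F]_n) :
  eigenvalue A 0 = (A \notin unitmx).
Proof.
by rewrite /eigenvalue /eigenspace raddf0 subr0 kermx_eq0 row_free_unit.
Qed.

Section Tight.
Variable R : realType.

(** A real skew-symmetric matrix is unitarily diagonalizable over the complex
    numbers, with purely imaginary eigenvalues l.  Since conj l = - l, each l
    satisfies l ^ 2 = - |l| ^ 2, so that a common modulus c of the nonzero
    eigenvalues turns into the polynomial identity G ^ 3 = - c ^ 2 G. *)
Lemma skew_cube n (G : 'M[R]_n) (c : R) :
  G^T = - G ->
  (forall l, in_spectrum G l -> l != 0 -> `|l| = real_complex R c) ->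
  G *m G *m G = - c ^+ 2 *: G.
Proof.
move=> skG spG; set M := map_mx (real_complex R) G.
have Mstar : map_mx Num.conj M^T = - M.
  rewrite /M map_trmx skG map_mxN map_mxN -map_mx_comp; congr (- _).
  by apply/matrixP => i j; rewrite !mxE /= conj_Creal // complex_real.
have /orthomx_spectralP : M \is normalmx.
  by apply/normalmxP; rewrite Mstar mulmxN mulNmx.
set P := spectralmx M; set D := spectral_diag M => defM.
have uP : P \is unitarymx := spectral_unitarymx M.
have unitP : P \in unitmx := spectral_unit M.
have defD : diag_mx D = P *m M *m invmx P.
  by rewrite defM !mulmxA mulmxV // mul1mx mulmxK.
(* diag_mx D is unitarily similar to M, hence skew-Hermitian as well *)
have Dconj i : (D 0 i)^* = - D 0 i.
  have : map_mx Num.conj (diag_mx D)^T = - diag_mx D.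
    rewrite defD invmx_unitary // !trmx_mul !map_mxM /= trmxCK Mstar.
    by rewrite mulNmx mulmxN mulmxA.
  by move/matrixP/(_ i i); rewrite !mxE eqxx mulr1n.
have Dsp i : in_spectrum G (D 0 i).
  apply/eigenvalueP; exists (row i P).
    rewrite -row_mul -/M defM !mulmxA mulmxV // mul1mx row_mul row_diag_mx.
    by rewrite -scalemxAl -rowE.
  apply: contraTneq unitP => Pi0; rewrite unitmxE unitfE negbK.
  rewrite (expand_det_row _ i) big1 // => j _.
  by move/rowP/(_ j): Pi0; rewrite !mxE => ->; rewrite mul0r.
have Dcube i : D 0 i ^+ 3 = - (real_complex R c) ^+ 2 * D 0 i.
  have [->|D0] := eqVneq (D 0 i) 0; first by rewrite expr0n mulr0.
  by rewrite -(spG _ (Dsp i) D0) normCK Dconj mulrN opprK -expr2 -exprSr.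
apply: (map_mx_inj (f := real_complex R)).
rewrite map_mxZ !map_mxM /= -/M {1 2 3}defM.
have cancel A : invmx P *m A *m P *m (invmx P *m diag_mx D *m P) =
                invmx P *m (A *m diag_mx D) *m P.
  by rewrite !mulmxA mulmxK.
rewrite !cancel !mulmx_diag [X in _ *: X]defM scalemxAl scalemxAr.
congr (_ *m _ *m _); apply/matrixP => i j; rewrite !mxE mulrnAr.
congr (_ *+ _).
by rewrite rmorphN rmorphXn /= -Dcube exprSr expr2.
Qed.
(** The frame operator and the Gram matrix are the two products of Phi and its
    dagger, so they share their nonzero eigenvalues; only the Gram matrix is
    skew-symmetric, which is what makes it diagonalizable.  The rank is d
    because the square of the invertible frame operator factors through the
    Gram matrix. *)
Lemma tight_gram d n (Phi : 'M[R]_(d, n)) c : tight_with Phi c ->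
  \rank (gram Phi) = d /\
  gram Phi *m gram Phi *m gram Phi = - c ^+ 2 *: gram Phi.
Proof.
case=> c0 _ spF.
have modF l : in_spectrum (frame_operator Phi) l -> `|l| = real_complex R c.
  by move/spF => cl; apply/eqP; rewrite eq_le andbC.
split; last first.
  apply: skew_cube (trmx_gram Phi) _ => l spl l0; apply: modF.
  move: spl; rewrite /in_spectrum /gram /frame_operator !map_mxM.
  exact: eigenvalue_mulmxC.
have unitF : frame_operator Phi \in unitmx.
  rewrite -(map_unitmx (real_complex R)) -[_ \in _]negbK -eigenvalue0.
  apply/negP => /modF; rewrite normr0 => /esym/eqP.
  by rewrite (fmorph_eq0 (real_complex R)) (gt_eqF c0).
apply/eqP; rewrite eqn_leq rank_gram_le /=.
have unitFF : frame_operator Phi *m frame_operator Phi \in unitmx.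
  by rewrite unitmx_mul unitF.
rewrite -[X in (X <= _)%N](mxrank_unit unitFF).
rewrite {2}/frame_operator mulmxA mul_frame_operator.
exact: leq_trans (mxrankM_maxl _ _) (mxrankM_maxr _ _).
Qed.

(** Phi has independent rows since its Gram matrix has rank d, and the cubic
    identity says F ^ 3 Phi = - k F Phi for the frame operator F.  Both Phi and
    the invertible F cancel, which leaves F ^ 2 = - k. *)
Lemma gram_tight d n (Phi : 'M[R]_(d, n)) k : 0 < k ->
  \rank (gram Phi) = d ->
  gram Phi *m gram Phi *m gram Phi = - k *: gram Phi ->
  tight_with Phi (Num.sqrt k).
Proof.
move=> k0 rkG G3; set F := frame_operator Phi.
have rkPhi : row_free Phi.
  rewrite /row_free eqn_leq rank_leq_row -[X in (X <= _)%N]rkG.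
  exact: mxrankM_maxr.
have GD : gram Phi *m gram Phi *m gram Phi = dagger Phi *m (F *m F) *m Phi.
  by rewrite /gram /F /frame_operator !mulmxA.
have unitF : F \in unitmx.
  have : (d <= \rank (F *m F))%N.
    have nk0 : - k != 0 by rewrite oppr_eq0 gt_eqF.
    rewrite -[X in (X <= _)%N]rkG -(mxrank_scale_nz _ nk0) -G3 GD.
    exact: leq_trans (mxrankM_maxl _ _) (mxrankM_maxr _ _).
  move=> rkFF; rewrite -row_free_unit /row_free eqn_leq rank_leq_row.
  exact: leq_trans rkFF (mxrankM_maxl _ _).
have FPhi : F *m Phi = Phi *m gram Phi := mul_frame_operator Phi.
have F2 : F *m F = (- k)%:M.
  apply: (row_free_inj rkPhi); apply: (can_inj (mulKmx unitF)).
  rewrite mul_scalar_mx -scalemxAr FPhi scalemxAr -G3.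
  move: (gram Phi) FPhi => G {GD}; clearbody F => FPhi; rewrite -!mulmxA FPhi.
  by rewrite (mulmxA F Phi) FPhi -(mulmxA Phi) (mulmxA F Phi) FPhi -mulmxA.
split; rewrite ?sqrtr_gt0 // => l /eigenvalueP[v vF v0].
have l2 : l ^+ 2 = - real_complex R k.
  apply/eqP; rewrite -subr_eq0; apply: contraNT v0 => l2k.
  rewrite -(inj_eq (scalerI l2k)) scaler0 scalerBl expr2 -scalerA -vF.
  rewrite scalemxAl -vF -mulmxA -map_mxM F2 map_scalar_mx.
  by rewrite mul_mx_scalar rmorphN subrr.
suff -> : `|l| = real_complex R (Num.sqrt k) by rewrite lexx.
apply/eqP; rewrite -(eqrXn2 (ltn0Sn 1)) ?normr_ge0 //; last first.
  by rewrite lecR sqrtr_ge0.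
rewrite -normrX l2 normrN -rmorphXn /= sqr_sqrtr ?ltW //.
by rewrite ger0_norm // lecR ltW.
Qed.

(** The skew adjacency matrices of tournaments: the sign of the entry i, j says
    who wins the game between i and j. *)
Definition tournament_mx n (C : 'M[R]_n) : Prop :=
  C^T = - C /\ forall i j, i != j -> `|C i j| = 1.

(** The reduction of the geometry to matrix algebra: an ETF is, up to the scale
    mu and the choice of Phi for a given Gram matrix, a tournament matrix of
    rank d with a cubic identity. *)
Lemma ETF_existsP d n : ~~ odd d ->
  ETF_exists R d n <->
  exists2 C : 'M[R]_n, tournament_mx C &
    \rank C = d /\ exists2 k : R, 0 < k & C *m C *m C = - k *: C.
Proof.
move=> evd; split=> [[Phi [[_ [c tightPhi]] [mu mu0 eqPhi]]]|[C [skC C1]]].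
  have [rkG G3] := tight_gram tightPhi; have [c0 _ _] := tightPhi.
  exists (mu^-1 *: gram Phi).
    split; first by rewrite linearZ /= trmx_gram scalerN.
    move=> i j ij; rewrite mxE normrM eqPhi // ger0_norm ?invr_ge0 ?ltW //.
    by rewrite mulVf // gt_eqF.
  split; first by rewrite mxrank_scale_nz // invr_neq0 // gt_eqF.
  exists ((c / mu) ^+ 2); first by rewrite exprn_gt0 // divr_gt0.
  rewrite -!scalemxAl -!scalemxAr -!scalemxAl G3 !scalerA; congr (_ *: _).
  rewrite exprMn exprVn expr2 invfM !mulrN !mulNr; congr (- _).
  by rewrite mulrC !mulrA mulrC.
move=> [rkC [k k0 C3]].
have [|Phi defC] := skew_is_gram skC evd; first by rewrite rkC.
have tPhi : tight_with Phi (Num.sqrt k) by apply: gram_tight; rewrite ?defC.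
exists Phi; split.
  by split; [exists (Num.sqrt k), (Num.sqrt k)|exists (Num.sqrt k)].
by exists 1 => // i j ij; rewrite defC C1.
Qed.
End Tight.

(** * Tournament matrices and skew Hadamard matrices *)

Section Tournament.
Variable R : realType.

Lemma sub1_natS n : 1 - n.+1%:R = - n%:R :> R.
Proof. by rewrite -natr1 opprD addrCA subrr addr0. Qed.

Lemma tournament_sqr_diag n (C : 'M[R]_n) i :
  tournament_mx C -> (C *m C) i i = 1 - n%:R.
Proof.
case=> skC C1; rewrite mxE (bigD1 i) //= (skew_diag i skC) mulr0 add0r.
rewrite (eq_bigr (fun=> -1)) => [|j ji].
  rewrite sumr_const cardC1 card_ord mulNrn.
  by case: n i {C skC C1} => [[]//|n] i; rewrite sub1_natS.
have -> : C j i = - C i j by rewrite -[in RHS](trmxK C) skC !mxE opprK.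
by rewrite mulrN -expr2 -real_normK ?num_real // C1 1?eq_sym // expr1n.
Qed.

Lemma tournament_int n (C : 'M[R]_n) : tournament_mx C ->
  exists2 B : 'M[int]_n, map_mx intr B = C &
    forall i j, i != j -> B i j = 1 \/ B i j = -1.
Proof.
case=> skC C1.
pose B : 'M[int]_n :=
  \matrix_(i, j) if C i j == 0 then 0 else if 0 < C i j then 1 else -1.
exists B; last first.
  move=> i j ij; rewrite mxE -normr_eq0 C1 // oner_eq0.
  by case: ifP; [left|right].
apply/matrixP => i j; rewrite !mxE.
have [->|ij] := eqVneq i j; first by rewrite (skew_diag j skC) eqxx.
rewrite -normr_eq0 C1 // oner_eq0; move: (C1 _ _ ij).
case: ltrgt0P => [_ -> //|_|->].
  by move=> /(canRL (@opprK _)) ->.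
by move/eqP; rewrite eq_sym oner_eq0.
Qed.

(** For H = C + 1 with C skew-symmetric, H H^T = (1 + C)(1 - C) = 1 - C ^ 2.  The
    diagonal of C vanishes, so the entries of H are signs exactly when C is a
    tournament matrix. *)
Lemma skew_hadamardP m : skew_hadamard_exists m <->
  exists2 C : 'M[R]_m, tournament_mx C & C *m C = (1 - m%:R)%:M.
Proof.
split=> [[H [[H1 HHT] [C skC defH]]]|[C tC C2]].
  exists (map_mx intr C).
    split; first by rewrite map_trmx skC map_mxN.
    move=> i j ij; have := H1 i j; rewrite defH !mxE (negbTE ij) addr0.
    by case=> ->; rewrite ?normrN normr1.
  have -> : 1 - m%:R = ((1 - m%:R : int)%:~R : R).
    by rewrite rmorphB rmorph1 rmorph_nat.
  rewrite -map_mxM -map_scalar_mx; congr map_mx.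
  move: HHT; rewrite defH linearD /= skC trmx1.
  rewrite mulmxDl !mulmxDr mul1mx mulmx1 mulmxN mulmx1 addrA addrK.
  by rewrite raddfB /= => <-; rewrite opprD opprK addrC subrK.
have [B defC B1] := tournament_int tC; have [skC _] := tC.
have inj_intr : injective (map_mx intr : 'M[int]_m -> 'M[R]_m).
  move=> X Y /matrixP XY; apply/matrixP => i j; have := XY i j.
  by rewrite !mxE; apply: intr_inj.
have skB : B^T = - B.
  by apply: inj_intr; rewrite -map_trmx defC skC map_mxN defC.
exists (B + 1%:M); split; last by exists B.
split=> [i j|].
  rewrite !mxE; have [->|ij] := eqVneq i j; last first.
    by rewrite addr0; apply: B1.
  by rewrite (skew_diag j skB); left.
have B2 : B *m B = (1 - m%:R)%:M.
  apply: inj_intr; rewrite map_mxM /= defC C2 map_scalar_mx /=; congr (_%:M).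
  by rewrite rmorphB rmorph1 rmorph_nat.
rewrite linearD /= skB trmx1 mulmxDl !mulmxDr mul1mx mulmx1 mulmxN mulmx1.
by rewrite addrA addrK B2 -raddfN -raddfD /= opprB subrK.
Qed.

(** Modulo 2 a tournament matrix is J - 1, with J the all-ones matrix.  In even
    order J ^ 2 vanishes modulo 2, so J - 1 is its own inverse and the integer
    determinant is odd. *)
Lemma tournament_even_unit n (C : 'M[R]_n) :
  tournament_mx C -> ~~ odd n -> C \in unitmx.
Proof.
move=> tC evn; have [B defC B1] := tournament_int tC; have [skC _] := tC.
rewrite -defC unitmxE det_map_mx unitfE intr_eq0.
have Bd i : B i i = 0.
  have := skew_diag i skC; rewrite -defC mxE => /eqP.
  by rewrite intr_eq0 => /eqP.
pose J : 'M['F_2]_n := const_mx 1.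
have defB : map_mx (intr : int -> 'F_2) B = J - 1%:M.
  apply/matrixP => i j; rewrite !mxE.
  have [->|ij] := eqVneq i j; first by rewrite Bd subrr.
  by rewrite subr0; case: (B1 i j ij) => ->; apply/val_inj.
have J2 : J *m J = 0.
  apply/matrixP => i j; rewrite !mxE (eq_bigr (fun=> 1)) => [|k _].
    rewrite sumr_const card_ord -(even_halfK evn) -mul2n mulrnA.
    by rewrite (_ : 1 *+ 2 = 0) ?mul0rn //; apply/val_inj.
  by rewrite !mxE mulr1.
have : (J - 1%:M) *m (J - 1%:M) = 1%:M.
  rewrite mulmxBl mul1mx mulmxBr mulmx1 J2 sub0r opprB addrCA -opprD.
  rewrite -[RHS]subr0; congr (_ - _); apply/matrixP => i j; rewrite !mxE.
  by apply/val_inj.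
move/mulmx1_unit => [+ _]; rewrite -defB unitmxE det_map_mx unitfE.
by apply: contraNneq => ->.
Qed.

(** A principal submatrix of a tournament matrix is one too, so the leading one
    of even order is invertible. *)
Lemma tournament_rank n (C : 'M[R]_n) m : tournament_mx C ->
  (m <= n)%N -> ~~ odd m -> (m <= \rank C)%N.
Proof.
move=> [skC C1] mn evm; pose f := widen_ord mn.
have tC' : tournament_mx (mxsub f f C).
  split.
    apply/matrixP => i j; move/matrixP/(_ (f i) (f j)): skC.
    by rewrite !mxE.
  by move=> i j ij; rewrite mxE C1.
rewrite -[X in (X <= _)%N](mxrank_unit (tournament_even_unit tC' evm)).
rewrite -[C in mxsub _ _ C]mulmx1 mxsub_mul (leq_trans (mxrankM_maxl _ _)) //.
exact/mxrankS/rowsub_sub.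
Qed.

(** The rank d of the Gram matrix is at least the largest even number that does
    not exceed n, so n = d.+2 is already impossible. *)
Lemma ETF_size d n : ~~ odd d -> ETF_exists R d n -> n = d \/ n = d.+1.
Proof.
move=> evd /(ETF_existsP _ _ evd)[C tC [rkC _]].
have dn : (d <= n)%N by rewrite -rkC rank_leq_row.
case: (ltnP d.+1 n) => [d2n|nd1].
  have := tournament_rank tC d2n; rewrite rkC /= negbK => /(_ evd).
  by rewrite ltnNge leqnSn.
move: dn; rewrite leq_eqVlt => /orP[/eqP|dn]; first by left.
by right; apply/eqP; rewrite eqn_leq nd1.
Qed.

(** Three mutually orthogonal rows x, y, z of signs give
    m = \sum_k (x_k + y_k) (x_k + z_k), and both factors of each term are even. *)
Lemma hadamard_order m (H : 'M[int]_m) : hadamard H -> (2 < m)%N -> (4 %| m)%N.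
Proof.
case=> H1 HHT m2.
have rowdot i j : \sum_k H i k * H j k = m%:R *+ (i == j).
  move/matrixP/(_ i j): HHT; rewrite !mxE => <-.
  by apply: eq_bigr => k _; rewrite mxE.
pose i0 := Ordinal (ltn_trans (ltn_trans (ltn0Sn 0) (ltnSn 1)) m2).
pose i1 := Ordinal (ltn_trans (ltnSn 1) m2); pose i2 := Ordinal m2.
have defm : m%:R = \sum_k (H i0 k + H i1 k) * (H i0 k + H i2 k) :> int.
  under eq_bigr do rewrite mulrDl !mulrDr.
  by rewrite !big_split /= !rowdot /= !addr0.
have : (4 %| (m%:R)%R)%Z.
  rewrite defm; apply: rpred_sum => k _.
  by case: (H1 i0 k) (H1 i1 k) (H1 i2 k) => -> [] -> [] ->.
by rewrite natz.
Qed.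

Lemma skew_hadamard_order m : skew_hadamard_exists m -> (2 < m)%N -> (4 %| m)%N.
Proof. by case=> H [hadH _]; apply: hadamard_order hadH. Qed.

End Tournament.

(** * Square frames and frames with one extra vector *)

Lemma rank1_minor (F : fieldType) m n (Q : 'M[F]_(m, n)) i j k l :
  (\rank Q <= 1)%N -> Q i j * Q k l = Q i l * Q k j.
Proof.
move=> rkQ; rewrite -(mulmx_base Q); move: rkQ (col_base Q) (row_base Q).
case: (\rank Q) => [|[|//]] _ U V; rewrite !mxE.
  by rewrite !big_ord0 !mul0r.
by rewrite !big_ord1 mulrACA [X in _ * X]mulrC mulrACA.
Qed.

Section Zauner.
Variable R : realType.

(** At full rank the cubic identity becomes C ^ 2 = - k, and the diagonal of
    C ^ 2 forces k = d - 1, the identity for a skew Hadamard matrix. *)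
Lemma square_ETF_skew_hadamard d : ~~ odd d -> (1 < d)%N ->
  ETF_exists R d d <-> skew_hadamard_exists d.
Proof.
move=> evd d1; rewrite ETF_existsP // (skew_hadamardP R).
split=> [[C tC [rkC [k k0 C3]]]|[C tC C2]]; exists C => //.
  have unitC : C \in unitmx by rewrite -row_free_unit /row_free rkC.
  have C2 : C *m C = (- k)%:M.
    by rewrite -(mulmxK unitC (C *m C)) C3 -scalemxAl mulmxV // scalemx1.
  have := tournament_sqr_diag (Ordinal d1) tC.
  by rewrite C2 mxE eqxx mulr1n => ->.
have k0 : 0 < d%:R - 1 :> R by rewrite subr_gt0 ltr1n.
split; last by exists (d%:R - 1) => //; rewrite C2 mul_scalar_mx opprB.
apply: mxrank_unit; suff : C *m C \in unitmx by rewrite unitmx_mul => /andP[].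
by rewrite C2 unitmxE det_scalar unitfE expf_neq0 // -opprB oppr_eq0 gt_eqF.
Qed.

(** The cubic identity makes Q = C ^ 2 + k a multiple of the orthogonal
    projection onto the kernel of C, which is a line.  The diagonal of C ^ 2 is
    constant, hence so is the diagonal of Q, and the vanishing 2 x 2 minors of
    Q give all its entries the same absolute value q.  Comparing the diagonals
    in Q ^ 2 = k Q yields q = 1; thus Q is a sign matrix of rank 1, and its first
    row is the sought vector. *)
Lemma corank1_tournament n (C : 'M[R]_n.+1) k : (0 < n)%N ->
  tournament_mx C -> \rank C = n -> 0 < k -> C *m C *m C = - k *: C ->
  exists s : 'rV[R]_n.+1,
    [/\ forall i, `|s 0 i| = 1, s *m C = 0
      & C *m C = s^T *m s - (n.+1%:R)%:M].
Proof.
move=> n0 tC rkC k0 C3; have [skC _] := tC.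
set Q := C *m C + k%:M.
have QC : Q *m C = 0.
  by rewrite mulmxDl C3 mul_scalar_mx -scalerDl addNr scale0r.
have rkQ : (\rank Q <= 1)%N.
  have /mxrankS := introT sub_kermxP QC.
  by rewrite mxrank_ker rkC subSnn.
have Qsym i j : Q i j = Q j i.
  have : Q^T = Q.
    by rewrite linearD /= trmx_mul skC mulNmx mulmxN opprK tr_scalar_mx.
  by move/matrixP/(_ j i); rewrite mxE.
set q : R := k - n%:R.
have Qd i : Q i i = q.
  by rewrite mxE tournament_sqr_diag // mxE eqxx mulr1n sub1_natS addrC.
have Qsq i j : Q i j ^+ 2 = q ^+ 2.
  by rewrite expr2 [X in _ * X]Qsym rank1_minor // !Qd.
have QQ : Q *m Q = k *: Q.
  by rewrite {2}/Q mulmxDr mulmxA QC mul0mx add0r mul_mx_scalar.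
have nq : n.+1%:R * q ^+ 2 = k * q.
  move/matrixP/(_ 0 0): QQ; rewrite mxE [RHS]mxE Qd => <-.
  under eq_bigr => j _ do rewrite [X in _ * X]Qsym -expr2 Qsq.
  by rewrite sumr_const card_ord mulr_natl.
(* otherwise Q = 0, and C ^ 2 = - k would make C invertible *)
have q0 : q != 0.
  apply: contraTneq (ltnSn n) => q0; rewrite -leqNgt -[X in (_ <= X)%N]rkC.
  have Q0 : Q = 0.
    apply/matrixP => i j; rewrite [RHS]mxE; apply/eqP.
    by rewrite -sqrf_eq0 Qsq q0 expr0n.
  have : C *m C \in unitmx.
    move/eqP: Q0; rewrite addr_eq0 => /eqP ->.
    by rewrite -raddfN unitmxE det_scalar unitfE expf_neq0 // oppr_eq0 gt_eqF.
  by rewrite unitmx_mul => /andP[/mxrank_unit -> _].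
(* k = q + n and (n + 1) q = k *)
have q1 : q = 1.
  have : n.+1%:R * q = k by apply: (mulIf q0); rewrite -mulrA -expr2 nq.
  have -> : k = q + n%:R by rewrite subrK.
  rewrite -natr1 mulrDl mul1r addrC => /addrI /eqP.
  rewrite -subr_eq0 -{2}(mulr1 n%:R) -mulrBr mulf_eq0 pnatr_eq0 -leqn0.
  by rewrite leqNgt n0 /= subr_eq0 => /eqP.
exists (row 0 Q); split.
- move=> i; rewrite mxE; apply/eqP; rewrite -sqrp_eq1 ?normr_ge0 //.
  by rewrite real_normK ?num_real // Qsq q1 expr1n.
- by rewrite -row_mul QC; apply/matrixP => i j; rewrite !mxE.
- have -> : (row 0 Q)^T *m row 0 Q = Q.
    apply/matrixP => i j; rewrite [LHS]mxE big_ord1 tr_row.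
    rewrite [col _ _ _ _]mxE [row _ _ _ _]mxE [_^T _ _]mxE [X in X * _]Qsym.
    by rewrite (rank1_minor i 0 0 j rkQ) Qd q1 mulr1.
  have -> : n.+1%:R = k; last by rewrite addrK.
  by move/eqP: q1; rewrite subr_eq => /eqP ->; rewrite -natr1 addrC.
Qed.

Definition border n (s : 'rV[R]_n) (C : 'M[R]_n) : 'M[R]_(1 + n) :=
  block_mx 0 s (- s^T) C.

Lemma border_sqr n (s : 'rV[R]_n) (C : 'M[R]_n) : C^T = - C ->
  border s C *m border s C =
  block_mx (- (s *m s^T)) (s *m C) ((s *m C)^T) (C *m C - s^T *m s).
Proof.
move=> skC; rewrite mulmx_block !mul0mx !mulmx0 add0r mulmxN !add0r mulNmx.
by rewrite trmx_mul skC mulNmx mulmxN [in X in block_mx _ _ _ X]addrC.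
Qed.

Lemma border_tournament n (s : 'rV[R]_n) (C : 'M[R]_n) :
  tournament_mx (border s C) <-> tournament_mx C /\ forall i, `|s 0 i| = 1.
Proof.
split=> [[sk B1]|[[skC C1] s1]].
  split; last first.
    move=> i; have := B1 (lshift n 0) (rshift 1 i).
    by rewrite block_mxEur; apply.
  split.
    move: sk; rewrite tr_block_mx opp_block_mx => /eq_block_mx[_ _ _]; exact.
  move=> i j ij; have := B1 (rshift 1 i) (rshift 1 j).
  by rewrite block_mxEdr; apply; rewrite (inj_eq (@rshift_inj _ _)).
split.
  by rewrite tr_block_mx opp_block_mx skC trmx0 oppr0 linearN /= trmxK opprK.
move=> i j; case: (split_ordP i) => i' ->; case: (split_ordP j) => j' ->.
- by rewrite !ord1 eqxx.
- by rewrite block_mxEur ord1 s1.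
- by rewrite block_mxEdl ord1 !mxE normrN s1.
- by rewrite block_mxEdr (inj_eq (@rshift_inj _ _)); apply: C1.
Qed.

Lemma skew_borderE n (B : 'M[R]_(1 + n)) : B^T = - B ->
  B = border (ursubmx B) (drsubmx B).
Proof.
move=> sk; rewrite -[LHS]submxK /border; congr block_mx.
  by apply/matrixP => i j; rewrite !ord1 [RHS]mxE !mxE (skew_diag _ sk).
by rewrite trmx_ursub sk; apply/matrixP => i j; rewrite !mxE opprK.
Qed.

(** Bordering C by the sign vector s of its kernel adds s s^T = n to the corner
    and cancels s^T s in the block of C ^ 2, so C ^ 2 = s^T s - n becomes the skew
    Hadamard identity.  Conversely, deleting a row and a column of a skew
    Hadamard matrix leaves such a C; its kernel is spanned by the deleted row,
    and C s^T = 0 turns the quadratic identity into the cubic one. *)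
Lemma corank1_ETF_skew_hadamard d : ~~ odd d -> (1 < d)%N ->
  ETF_exists R d d.+1 <-> skew_hadamard_exists d.+2.
Proof.
move=> evd d1; rewrite ETF_existsP // (skew_hadamardP R).
split=> [[C tC [rkC [k k0 C3]]]|[B tB B2]].
  have [s [s1 sC C2]] := corank1_tournament (ltnW d1) tC rkC k0 C3.
  have [skC _] := tC; exists (border s C); first by apply/border_tournament.
  rewrite border_sqr // sC trmx0 C2 addrAC subrr add0r.
  rewrite sub1_natS.
  have -> : s *m s^T = (d.+1%:R)%:M.
    apply/matrixP => i j; rewrite !ord1 !mxE eqxx mulr1n.
    under eq_bigr => l _.
      rewrite mxE -expr2 -real_normK ?num_real // s1 expr1n; over.
    by rewrite sumr_const card_ord.
  by rewrite [RHS](scalar_mx_block 1 d.+1) -!raddfN.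
pose s : 'rV[R]_d.+1 := ursubmx (B : 'M_(1 + d.+1)).
pose C : 'M[R]_d.+1 := drsubmx (B : 'M_(1 + d.+1)).
have [skB _] := tB.
have defB := skew_borderE (skB : (B : 'M_(1 + d.+1))^T = - B).
have [tC s1] : tournament_mx C /\ forall i, `|s 0 i| = 1.
  by apply/border_tournament; rewrite -defB.
have [skC _] := tC.
have [sC C2] : s *m C = 0 /\ C *m C = s^T *m s - (d.+1%:R)%:M.
  have := border_sqr s skC; rewrite -defB B2.
  rewrite sub1_natS.
  rewrite (scalar_mx_block 1 d.+1) => /eq_block_mx[_ <- _ E]; split => //.
  by rewrite -[LHS](subrK (s^T *m s)) -E addrC raddfN.
exists C => //; split; last first.
  exists d.+1%:R; first by rewrite ltr0n.
  by rewrite C2 mulmxBl -mulmxA sC mulmx0 sub0r mul_scalar_mx scaleNr.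
apply/eqP; rewrite eqn_leq; apply/andP; split.
  rewrite -ltnS ltn_neqAle rank_leq_row andbT; apply/negP => /row_freeP[C' CC'].
  have := s1 0; rewrite -[s]mulmx1 -CC' mulmxA sC mul0mx mxE normr0 => /eqP.
  by rewrite eq_sym oner_eq0.
have : (d.+1 <= \rank (C *m C - s^T *m s)%R)%N.
  rewrite C2 addrAC subrr add0r mxrank_opp mxrank_unit // unitmxE det_scalar.
  by rewrite unitfE expf_neq0 // pnatr_eq0.
move/leq_trans/(_ (mxrank_add _ _)); rewrite mxrank_opp => rk.
rewrite -ltnS (leq_trans rk) // -[X in (_ <= X)%N]addn1.
rewrite leq_add ?mxrankM_maxr //.
exact: leq_trans (mxrankM_maxr _ _) (rank_leq_row _).
Qed.

End Zauner.

(** * The equivalence of the two conjectures *)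

Theorem theorem3 (R : realType) :
  (symplectic_zauner_conjecture R <-> skew_hadamard_conjecture) /\
  (forall d : nat, ~~ odd d -> (1 < d)%N ->
     (ETF_exists R d d <-> skew_hadamard_exists d) /\
     (ETF_exists R d d.+1 <-> skew_hadamard_exists d.+2)).
Proof.
have partA := @square_ETF_skew_hadamard R.
have partB := @corank1_ETF_skew_hadamard R.
split; last by move=> d evd d1; split; [exact: partA|exact: partB].
split=> [SZ m m0 hm|SH d n evd d1 n0].
  case: hm => [->|[->|m4]].
  - exists 1%:M; split; last by exists 0; rewrite ?trmx0 ?oppr0 ?add0r.
    split; last by rewrite trmx1 mulmx1.
    by move=> i j; rewrite !ord1 mxE eqxx; left.
  - by apply/partA => //; apply/SZ => //; left; split; [|right].
  - have evm : ~~ odd m by rewrite -dvdn2 (dvdn_trans _ m4).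
    have m1 : (1 < m)%N by rewrite (leq_trans _ (dvdn_leq m0 m4)).
    by apply/partA => //; apply/SZ => //; left; split => //; left; apply/eqP.
split.
  move=> etf; have [n_d|n_d] := ETF_size evd etf; subst n.
    left; split=> //; have := d1.
    rewrite leq_eqVlt => /orP[/eqP <-|d2]; first by right.
    left; apply/eqP; apply: skew_hadamard_order d2; exact/partA.
  right; split=> //; have : (4 %| d.+2)%N.
    by apply: skew_hadamard_order; [exact/partB|rewrite !ltnS ltnW].
  by move=> d4; apply/eqP; rewrite -(eqn_modDr 2) addn2.
case=> [[-> hd]|[-> hd]].
  apply/partA => //; apply: SH; first exact: ltnW.
  by right; case: hd => [/eqP|]; [right|left].
apply/partB => //; apply: SH => //; right; right.
by rewrite -(addn2 d) /dvdn -modnDml hd.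
Qed.
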